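(* Let $f$ and $g$ be partial Boolean functions. Then $\mathrm{RS}(f\circ g)\ge\mathrm{RS}(f)\,\mathrm{RS}(g)$.
   Context: A partial Boolean function on $n$ bits is $f:\mathrm{Dom}(f)\to\{0,1\}$ with $\mathrm{Dom}(f)\subseteq\{0,1\}^n$. For $f$ on $n$ bits and $g$ on $k$ bits, $f\circ g$ is the partial function on $nk$ bits with domain $\{(x_1,\dots,x_n):x_i\in\mathrm{Dom}(g),(g(x_1),\dots,g(x_n))\in\mathrm{Dom}(f)\}$ and value $f(g(x_1),\dots,g(x_n))$. Query notions apply to functions on alphabet $\{0,1,*,\dagger\}$, a query returning the symbol at that position. A randomized algorithm is a probability distribution over deterministic decision trees; $\mathrm{R}_0(h)$ is the minimum, over randomized algorithms that are always correct on every input in the domain of $h$, of the maximum over inputs of the expected number of queries. Sabotage: $P_f\subseteq\{0,1,*\}^n$ is the set of $p$ for which there exist $x,y\in\mathrm{Dom}(f)$ with $f(x)\ne f(y)$ and $x_i=y_i=p_i$ whenever $p_i\ne*$; $P_f^\dagger$ is the same with $\dagger$ in place of $*$; $Q_f=P_f\cup P_f^\dagger$; $f_{\mathrm{sab}}:Q_f\to\{0,1\}$ is $0$ on $P_f$ and $1$ on $P_f^\dagger$; $\mathrm{RS}(f)=\mathrm{R}_0(f_{\mathrm{sab}})$. *)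

(* Defs.v *)
From HB Require Import structures.
From mathcomp Require Import all_boot all_order all_algebra.
From mathcomp Require Import all_classical all_reals all_analysis.

Set Implicit Arguments.
Unset Strict Implicit.
Unset Printing Implicit Defensive.

Import Order.TTheory GRing.Theory Num.Theory.
Local Open Scope ring_scope.

Inductive symbol : Type := Bit of bool | Star | Dagger.

Definition symbol_code (s : symbol) : option (option bool) :=
  match s with Bit b => Some (Some b) | Star => Some None | Dagger => None end.

Definition symbol_decode (c : option (option bool)) : symbol :=
  match c with Some (Some b) => Bit b | Some None => Star | None => Dagger end.

Lemma symbol_codeK : cancel symbol_code symbol_decode.
Proof. by case. Qed.

HB.instance Definition _ := Finite.copy symbol (can_type symbol_codeK).

(* A partial function A^n -> {0,1}; [None] means "outside the domain". *)
Definition pfun (A : Type) (n : nat) := {ffun 'I_n -> A} -> option bool.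

Definition pdom (A : finType) (n : nat) (h : pfun A n) : {set {ffun 'I_n -> A}} :=
  [set x | h x != None].

(* [mxvec_index i j : 'I_(n * k)] is position j of the i-th block of length k. *)
Definition block (A : finType) (n k : nat) (z : {ffun 'I_(n * k) -> A})
    (i : 'I_n) : {ffun 'I_k -> A} :=
  [ffun j => z (mxvec_index i j)].

(* The default [false] is never used: it is guarded by the domain test. *)
Definition pfun_comp (n k : nat) (f : pfun bool n) (g : pfun bool k) :
    pfun bool (n * k) :=
  fun z => if [forall i, block z i \in pdom g]
           then f [ffun i => odflt false (g (block z i))]
           else None.

(* The partial assignments p, with the mark s at unassigned positions, that are
   consistent with inputs x and y of different f-values: the set P_f for the
   mark *, and P_f^dagger for the mark dagger. The conditions on x and y
   already force every p i to be a bit or the mark s. *)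
Definition sabotaged (n : nat) (f : pfun bool n) (s : symbol) :
    {set {ffun 'I_n -> symbol}} :=
  [set p : {ffun 'I_n -> symbol} |
    [exists x in pdom f, exists y in pdom f,
      (f x != f y) &&
      [forall i, (p i != s) ==> (Bit (x i) == p i) && (Bit (y i) == p i)]]].

(* The two sets are disjoint, so the order of the tests is immaterial. *)
Definition fsab (n : nat) (f : pfun bool n) : pfun symbol n :=
  fun p => if p \in sabotaged f Star then Some false
           else if p \in sabotaged f Dagger then Some true
           else None.

Inductive dtree (n : nat) : Type :=
  | Leaf of bool
  | Query of 'I_n & (symbol -> dtree n).

HB.instance Definition _ (n : nat) := gen_eqMixin (dtree n).
HB.instance Definition _ (n : nat) := gen_choiceMixin (dtree n).

Fixpoint dt_output (n : nat) (t : dtree n) (x : {ffun 'I_n -> symbol}) : bool :=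
  match t with
  | Leaf b => b
  | Query i next => dt_output (next (x i)) x
  end.

Fixpoint dt_queries (n : nat) (t : dtree n) (x : {ffun 'I_n -> symbol}) : nat :=
  match t with
  | Leaf _ => 0
  | Query i next => (dt_queries (next (x i)) x).+1
  end.

(* A randomized algorithm: a discrete probability distribution over
   deterministic trees, of possibly infinite support. *)
Record ralg (R : realType) (n : nat) := RAlg {
  weight :> dtree n -> R;
  weight_ge0 : forall t, 0 <= weight t;
  weight_sum1 : \esum_(t in [set: dtree n]) (weight t)%:E = 1%E
}.

Definition zero_error (R : realType) (n : nat) (h : pfun symbol n)
    (w : ralg R n) : Prop :=
  forall t, 0 < w t -> forall x, x \in pdom h -> h x = Some (dt_output t x).

Definition expected_queries (R : realType) (n : nat) (w : ralg R n)
    (x : {ffun 'I_n -> symbol}) : \bar R :=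
  \esum_(t in [set: dtree n]) (w t * (dt_queries t x)%:R)%:E.

(* The maximum over an empty domain is 0. *)
Definition worst_case (R : realType) (n : nat) (h : pfun symbol n)
    (w : ralg R n) : \bar R :=
  \big[maxe/0%E]_(x in pdom h) expected_queries w x.

(* The infimum is a minimum: dropping repeated queries never increases the cost
   and leaves finitely many trees. *)
Definition R0 (R : realType) (n : nat) (h : pfun symbol n) : \bar R :=
  ereal_inf [set worst_case h w | w in [set w : ralg R n | zero_error h w]].

Definition RS (R : realType) (n : nat) (f : pfun bool n) : \bar R :=
  R0 R (fsab f).

(* Main.v *)
(** A correct algorithm for f_sab must always query a marked position. Restarting
    an algorithm that gives up shows that RS(f) is also the best ratio
    (expected number of queries)/(probability of finding a mark), so by
    minimax there is, for each c < RS(f), a distribution on sabotaged inputs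
    for which every tree, even one that may give up, has cost at least c *
    (probability of finding a mark). Take such distributions lam for f and mu
    for g. Draw p from lam and, independently, q_1, ..., q_n from mu; complete
    the marks of q_i according to p_i when p_i is a bit, and keep p_i as the
    mark otherwise. The result is a sabotaged input of f o g. A tree for f o
    g, run on it, yields a tree for f that queries p_i only when a mark of q_i
    is hit, hence hits on average at least c blocks; each hit in block i costs
    on average d queries inside this block by the choice of mu. *)
Require Import Defs.
From mathcomp Require Import all_boot all_order all_algebra.
From mathcomp Require Import all_classical all_reals all_analysis.
From mathcomp Require Import ring lra.

Set Implicit Arguments.
Unset Strict Implicit.
Unset Printing Implicit Defensive.

Import Order.TTheory GRing.Theory Num.Theory.
Local Open Scope ring_scope.

(** * Marks, queried positions and sabotaged inputs *)

Definition is_mark (s : symbol) : bool := if s is Bit _ then false else true.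

(** A set, so that repeated queries count once: every tree then costs at most [n], which gives the
    bounded payoffs that the minimax argument needs. *)
Fixpoint queried (n : nat) (t : dtree n) (x : {ffun 'I_n -> symbol}) : {set 'I_n} :=
  if t is Query i next then i |: queried (next (x i)) x else finset.set0.

Definition finds (n : nat) (t : dtree n) (x : {ffun 'I_n -> symbol}) : bool :=
  [exists i in queried t x, is_mark (x i)].

Lemma card_queried n (t : dtree n) x : (#|queried t x| <= dt_queries t x)%N.
Proof.
elim: t => [b|i next IH] /=; first by rewrite cards0.
rewrite cardsU1; apply: leq_trans (leq_add (leq_b1 _) (IH _)) _.
by rewrite add1n.
Qed.

Lemma finds_leaf n b (x : {ffun 'I_n -> symbol}) : finds (Leaf n b) x = false.
Proof. by apply/existsP => -[i]; rewrite /= inE. Qed.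

Lemma finds_query n (i : 'I_n) next x :
  finds (Query i next) x = is_mark (x i) || finds (next (x i)) x.
Proof.
apply/existsP/orP => [[j /andP[]] /=|[mi|/existsP[j /andP[qj mj]]]].
- rewrite !inE => /orP[/eqP->|qj] mj; [by left|right].
  by apply/existsP; exists j; rewrite qj.
- by exists i; rewrite /= !inE eqxx.
- by exists j; rewrite /= !inE qj orbT.
Qed.

Lemma sabotagedP n (f : pfun bool n) s (p : {ffun _ -> symbol}) :
  reflect (exists x y, [/\ f x != None, f y != None, f x != f y &
      forall i, p i != s -> Bit (x i) = p i /\ Bit (y i) = p i])
    (p \in sabotaged f s).
Proof.
rewrite inE; apply: (iffP existsP) => [[x /andP[dx /existsP[y]]]|].
  case/and3P=> dy fxy /forallP H; exists x, y; split=> //.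
  - by move: dx; rewrite inE.
  - by move: dy; rewrite inE.
  - by move=> i pi; have /implyP/(_ pi)/andP[/eqP ? /eqP ?] := H i.
move=> [x [y [dx dy fxy H]]]; exists x; rewrite inE dx /=.
apply/existsP; exists y; rewrite inE dy fxy /=.
by apply/forallP => i; apply/implyP => /H[-> ->]; rewrite eqxx.
Qed.

Lemma sabotaged_mark n (f : pfun bool n) s (p : {ffun _ -> symbol}) :
  p \in sabotaged f s -> exists i, p i = s.
Proof.
case/sabotagedP=> x [y [_ _ fxy H]].
case: (pickP (fun i => p i == s)) => [i /eqP pi|pN]; first by exists i.
case/eqP: fxy; congr f; apply/ffunP => i.
have [ex ey] := H i (negbT (pN i)).
suff: Bit (x i) = Bit (y i) by case.
by rewrite ex ey.
Qed.

Lemma sabotaged_symbol n (f : pfun bool n) s (p : {ffun _ -> symbol}) i :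
  p \in sabotaged f s -> is_mark (p i) -> p i = s.
Proof.
case/sabotagedP=> x [y [_ _ _ H]] mi; apply/eqP/negPn/negP => /H[ex _].
by rewrite -ex in mi.
Qed.

Lemma fsabP n (f : pfun bool n) p b : fsab f p = Some b <->
  p \in sabotaged f (if b then Dagger else Star).
Proof.
rewrite /fsab; case: ifPn => pS; case: b; split=> // pD.
- have [i pi] := sabotaged_mark pD.
  by have := sabotaged_symbol (i := i) pS; rewrite pi => /(_ isT).
- by case: ifP pD.
- by rewrite pD.
- by case: ifP pD.
- by rewrite pD in pS.
Qed.

Lemma pdom_fsabP n (f : pfun bool n) p :
  reflect (exists b, fsab f p = Some b) (p \in pdom (fsab f)).
Proof.
rewrite inE; case: (fsab f p) => [b|] /=; constructor; first by exists b.
by case.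
Qed.

(** * Correct trees, and restarting a tree that gives up *)

Definition correct n (f : pfun bool n) (t : dtree n) :=
  forall x, x \in pdom (fsab f) -> fsab f x = Some (dt_output t x).

Definition swap_marks n (p : {ffun 'I_n -> symbol}) : {ffun 'I_n -> symbol} :=
  [ffun i => match p i with Bit b => Bit b | Star => Dagger | Dagger => Star end].

Lemma fsab_swap n (f : pfun bool n) p b :
  fsab f p = Some b -> fsab f (swap_marks p) = Some (~~ b).
Proof.
move=> /fsabP/sabotagedP[x [y [dx dy fxy H]]]; apply/fsabP/sabotagedP.
exists x, y; split=> // i; rewrite ffunE; move: (H i).
by case: b {H} => /=; case: (p i) => [c||] //= H _; case: H.
Qed.

Lemma dt_output_swap n (t : dtree n) x :
  ~~ finds t x -> dt_output t (swap_marks x) = dt_output t x.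
Proof.
elim: t => [//|i next IH]; rewrite finds_query negb_or => /andP[mi].
rewrite /= ffunE; case ex: (x i) => [c||]; rewrite ex in mi => //.
exact: IH.
Qed.

(** A tree that sees no mark cannot tell [x] from [swap_marks x], on which [fsab f] takes the
    opposite value. *)
Lemma correct_finds n (f : pfun bool n) t x :
  correct f t -> x \in pdom (fsab f) -> finds t x.
Proof.
move=> ct dx; apply: contraT => /dt_output_swap E.
have [b fx] := pdom_fsabP _ _ dx; have fx' := fsab_swap fx.
have dx' : swap_marks x \in pdom (fsab f) by apply/pdom_fsabP; eexists; exact: fx'.
move: (ct _ dx) (ct _ dx'); rewrite fx fx' E => -[->] [].
by case: dt_output.
Qed.

Fixpoint scan n (l : seq 'I_n) : dtree n :=
  if l is i :: l' then
    Query i (fun a => match a with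
                      | Bit _ => scan l' | Star => Leaf n false | Dagger => Leaf n true
                      end)
  else Leaf n false.

(* [known] records the bits already seen, so no query is repeated. *)
Fixpoint retry n (known : 'I_n -> option bool) (t s : dtree n) : dtree n :=
  match t with
  | Leaf _ => s
  | Query i next =>
    if known i is Some b then retry known (next (Bit b)) s
    else Query i (fun a =>
      match a with
      | Bit b => retry (fun j => if j == i then Some b else known j) (next a) s
      | Star => Leaf n false
      | Dagger => Leaf n true
      end)
  end.

Lemma scan_queries n (l : seq 'I_n) x : (dt_queries (scan l) x <= size l)%N.
Proof. by elim: l => //= i l IH; case: (x i). Qed.

Lemma mark_output n (f : pfun bool n) x b i : fsab f x = Some b ->
  match x i with Bit _ => True | Star => b = false | Dagger => b = true end.
Proof.
move=> /fsabP H; have := sabotaged_symbol (i := i) H.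
by case: (x i) => // /(_ isT); case: b {H}.
Qed.

Lemma scan_correct n (f : pfun bool n) : correct f (scan (enum 'I_n)).
Proof.
move=> x /pdom_fsabP[b fx]; rewrite fx; congr Some.
have [i xi] := sabotaged_mark (proj1 (fsabP _ _ _) fx).
have: i \in enum 'I_n by rewrite mem_enum.
elim: (enum 'I_n) => //= j l IH; rewrite inE => /orP[/eqP <-|il].
  by rewrite xi; case: (b).
have := mark_output j fx; case: (x j) => [c _||] //.
exact: IH.
Qed.

Lemma retry_correct n (f : pfun bool n) t s : correct f s ->
  correct f (retry (fun=> None) t s).
Proof.
move=> cs x dx; have [b fx] := pdom_fsabP _ _ dx.
have bs : dt_output s x = b by apply: Some_inj; rewrite -cs.
rewrite fx; congr Some.
suff: forall known, (forall i c, known i = Some c -> x i = Bit c) ->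
  b = dt_output (retry known t s) x by apply.
elim: t => //= i next IH known ok.
case ki: (known i) => [c|]; first exact: IH.
rewrite /=; have := mark_output i fx; case xi: (x i) => [c||] // _.
apply: IH => j d; case: (eqVneq j i) => [-> [<-] //|_]; exact: ok.
Qed.

(** [known] suppresses repeated queries, so the induction charges only positions outside its domain;
    the fallback [s] runs only if [t] met no mark. *)
Lemma retry_queries n (t s : dtree n) x :
  (dt_queries (retry (fun=> None) t s) x <=
   #|queried t x| + ~~ finds t x * dt_queries s x)%N.
Proof.
pose dom (known : 'I_n -> option bool) : {set 'I_n} := finset [pred j | known j : bool].
suff: forall known, (forall i c, known i = Some c -> x i = Bit c) ->
  (dt_queries (retry known t s) x <=
   #|queried t x :\: dom known| + ~~ finds t x * dt_queries s x)%N.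
  move=> /(_ (fun=> None)) /(_ ltac:(by [])) /leq_trans; apply.
  by rewrite leq_add2r; apply/subset_leq_card/finset.subsetDl.
elim: t => [b|i next IH] known ok; rewrite ?finds_leaf ?finds_query /=.
  by rewrite mul1n leq_addl.
case ki: (known i) => [c|].
  rewrite (ok _ _ ki) /=; apply: leq_trans (IH _ _ ok) _.
  by rewrite leq_add2r; apply: subset_leq_card; apply/finset.setSD/finset.subsetUr.
have inD : i \in (i |: queried (next (x i)) x) :\: dom known.
  by rewrite !inE ki eqxx.
rewrite (cardsD1 i) inD /= addSn ltnS add0n.
case xi: (x i) => [c||] //=.
have ok' j d : (if j == i then Some c else known j) = Some d -> x j = Bit d.
  by case: (eqVneq j i) => [-> [<-] //|_]; exact: ok.
apply: leq_trans (IH _ _ ok') _; rewrite leq_add2r; apply: subset_leq_card.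
apply/fintype.subsetP => j; rewrite !inE.
by case: eqP => //= _ /andP[-> ->].
Qed.

(** * An approximate minimax theorem by regret matching *)

Section Minimax.
Variables (R : realType) (T : finType) (I : Type) (D : {set T}).

Definition is_distribution (mu : T -> R) :=
  [/\ forall p, 0 <= mu p, forall p, p \notin D -> mu p = 0 & \sum_p mu p = 1].

Variables (v : I -> T -> R) (B : R) (i0 : I).
Hypothesis v_bound : forall i p, `|v i p| <= B.
Hypothesis v_response : forall mu, is_distribution mu ->
  exists i, \sum_p mu p * v i p <= 0.

Let pos (x : R) := Num.max 0 x.

Let total (L : seq I) p := \sum_(i <- L) v i p.

Let pos_ge0 x : 0 <= pos x. Proof. by rewrite /pos le_max lexx. Qed.

(** Normalising the positive parts gives a distribution to which [v_response] applies; if they all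
    vanish, any answer will do, hence [i0]. *)
Lemma best_response (L : seq I) :
  exists i, \sum_(p in D) pos (total L p) * v i p <= 0.
Proof.
pose m p := if p \in D then pos (total L p) else 0.
have m0 p : 0 <= m p by rewrite /m; case: ifP.
have mE i : \sum_(p in D) pos (total L p) * v i p = \sum_p m p * v i p.
  rewrite big_mkcond; apply: eq_bigr => p _; rewrite /m.
  by case: ifP; rewrite // mul0r.
have [s0|s0] := eqVneq (\sum_p m p) 0.
  exists i0; rewrite mE big1 // => p _.
  by have /psumr_eq0P -> := s0; rewrite ?mul0r.
have sgt0 : 0 < \sum_p m p by rewrite lt0r s0 sumr_ge0.
have [|i vi] := v_response (mu := fun p => m p / \sum_p m p).
  split=> [p|p /negbTE pD|]; first by rewrite divr_ge0 // ltW.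
    by rewrite /m pD mul0r.
  by rewrite -mulr_suml divff.
exists i; rewrite mE -(pmulr_rle0 _ (x := (\sum_p m p)^-1)) ?invr_gt0 //.
by rewrite mulr_sumr; under eq_bigr do rewrite mulrA (mulrC _^-1).
Qed.

(* Regret matching: answering the positive part of the current total keeps the
   squared norm of that positive part growing at most linearly in [N]. *)
Lemma regret_matching (N : nat) : exists2 L : seq I, size L = N &
  \sum_(p in D) pos (total L p) ^+ 2 <= N%:R * (#|D|%:R * B ^+ 2).
Proof.
elim: N => [|N [L sL HL]].
  exists [::] => //; rewrite mul0r big1 // => p _.
  by rewrite /total big_nil /pos maxxx expr0n.
have [i vi] := best_response L; exists (i :: L); first by rewrite /= sL.
apply: le_trans (_ : \sum_(p in D) (pos (total L p) ^+ 2 +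
    (pos (total L p) * v i p) *+ 2 + B ^+ 2) <= _); last first.
  rewrite !big_split /= sumr_const -[X in _ + X]mulr_natl.
  by rewrite -natr1 mulrDl mul1r; move: HL vi; lra.
apply: ler_sum => p _; rewrite /total big_cons -/(total L p).
have vB : v i p ^+ 2 <= B ^+ 2.
  have B0 : 0 <= B by exact: le_trans (v_bound i p).
  by rewrite -real_normK ?num_real // lerXn2r ?nnegrE.
have: pos (v i p + total L p) ^+ 2 <= (pos (total L p) + v i p) ^+ 2.
  rewrite /pos; case: (lerP 0 (v i p + _)) => h1; last by rewrite expr0n sqr_ge0.
  by case: (lerP 0 (total L p)) => h2; [rewrite addrC|nra].
by rewrite sqrrD; lra.
Qed.

(** A coordinate above [e * N] would contribute more than [e ^ 2 * N ^ 2] to the squared norm, which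
    regret matching keeps below [N * M]; this fails once [N] exceeds [M / e ^ 2]. *)
Lemma approach (e : R) : 0 < e -> exists2 L : seq I, (0 < size L)%N &
  forall p, p \in D -> total L p <= e * (size L)%:R.
Proof.
move=> e0; pose M := #|D|%:R * B ^+ 2.
have [N NM] : exists N : nat, M / e ^+ 2 < N%:R.
  by exists (Num.Def.truncn (M / e ^+ 2)).+1; exact: truncnS_gt.
have M0 : 0 <= M by rewrite mulr_ge0 ?sqr_ge0.
have N0 : 0 < N%:R :> R by apply: le_lt_trans NM; rewrite divr_ge0 ?sqr_ge0.
have [L sL HL] := regret_matching N.
exists L => [|p pD]; first by rewrite sL -(ltr0n R).
rewrite sL leNgt; apply/negP => lt_tot.
have tot0 : 0 < total L p by apply: lt_trans lt_tot; rewrite mulr_gt0.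
have le1 : total L p ^+ 2 <= N%:R * M.
  apply: le_trans HL; rewrite (bigD1 p) //=.
  have -> : pos (total L p) = total L p by rewrite /pos max_r // ltW.
  by rewrite lerDl; apply: sumr_ge0 => q _; exact: sqr_ge0.
have le2 : (e * N%:R) ^+ 2 < total L p ^+ 2.
  by rewrite ltrXn2r ?nnegrE ?ltW ?mulr_gt0.
have := lt_le_trans le2 le1; rewrite exprMn expr2 mulrA mulrC ltr_pM2l //.
by move: NM; rewrite ltr_pdivrMr ?exprn_gt0 // mulrC => /ltW/le_gtF ->.
Qed.

End Minimax.

(** * Uniform mixtures of finite lists of trees *)

Section UniformAlgorithm.
Variables (R : realType) (n : nat) (L : seq (dtree n)).
Hypothesis L0 : (0 < size L)%N.

Definition uniform_weight (t : dtree n) : R :=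
  \sum_(s <- L) (s == t)%:R / (size L)%:R.

Lemma esum_uniform (c : dtree n -> R) : (forall t, 0 <= c t) ->
  (\esum_(t in [set: dtree n]) (uniform_weight t * c t)%:E =
   (\sum_(s <- L) c s / (size L)%:R)%:E)%E.
Proof.
move=> c0; under eq_esum do rewrite /uniform_weight mulr_suml -sumEFin.
rewrite esum_sum => [|t s _ _]; last first.
  by rewrite lee_fin mulr_ge0 // divr_ge0.
rewrite -sumEFin; apply: eq_bigr => s _.
rewrite -[RHS](@esum_set1 _ _ s (fun t => (c t / (size L)%:R)%:E)); last first.
  by rewrite lee_fin divr_ge0.
rewrite [RHS]esum_mkcond; apply: eq_esum => t _.
rewrite eq_sym; case: (eqVneq t s) => [->|/eqP ts].
  by rewrite mem_set // mul1r mulrC.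
by rewrite memNset // !mul0r.
Qed.

Lemma uniform_weight_ge0 t : 0 <= uniform_weight t.
Proof. by apply: sumr_ge0 => s _; rewrite divr_ge0. Qed.

Lemma uniform_weight_sum1 :
  (\esum_(t in [set: dtree n]) (uniform_weight t)%:E = 1)%E.
Proof.
under eq_esum do rewrite -[uniform_weight _]mulr1.
rewrite (esum_uniform (c := fun=> 1)) // -mulr_suml big_const_seq count_predT.
by rewrite iter_addr addr0 divff // pnatr_eq0 -lt0n.
Qed.

Definition uniform_ralg : ralg R n := RAlg uniform_weight_ge0 uniform_weight_sum1.

Lemma uniform_weight_mem t : 0 < uniform_weight t -> t \in L.
Proof.
rewrite /uniform_weight; elim: (L) (size L) => [|s l IH] m; first by rewrite big_nil ltxx.
rewrite big_cons inE eq_sym; case: eqP => //= _.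
by rewrite mul0r add0r => /IH.
Qed.

End UniformAlgorithm.

Lemma RS_le (R : realType) n (f : pfun bool n) (L : seq (dtree n)) (C : R) :
  (0 < size L)%N -> (forall t, t \in L -> correct f t) -> 0 <= C ->
  (forall p, p \in pdom (fsab f) ->
     \sum_(t <- L) (dt_queries t p)%:R <= C * (size L)%:R) ->
  (RS R f <= C%:E)%E.
Proof.
move=> L0 cL C0 costL; apply: ge_ereal_inf.
exists (worst_case (fsab f) (uniform_ralg R L0)).
  by exists (uniform_ralg R L0) => // t /uniform_weight_mem tL x; exact: cL.
rewrite /worst_case; apply: bigmax_le; first by rewrite lee_fin.
move=> p pD; rewrite /expected_queries.
rewrite (esum_uniform L (fun t => ler0n R (dt_queries t p))) //.
by rewrite lee_fin -mulr_suml ler_pdivrMr ?ltr0n //; exact: costL.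
Qed.

(* The factor [finds t p] makes the bound meaningful for trees that may stop
   without having found a mark. *)
Definition hard_for (R : realType) n (f : pfun bool n) (c : R)
    (mu : {ffun 'I_n -> symbol} -> R) :=
  is_distribution (pdom (fsab f)) mu /\
  forall t, c * (\sum_p mu p * (finds t p)%:R) <= \sum_p mu p * #|queried t p|%:R.

(** * Hard distributions, obtained by restarting *)

Section Restart.
Variables (R : realType) (n : nat) (f : pfun bool n).
Local Notation Q := (pdom (fsab f)).

(** A list stands for the uniform mixture of its entries, repetitions included; independent choices
    from two lists then become the list of all pairs. *)
Definition achievable (C : R) := exists L : seq (dtree n),
  [/\ (0 < size L)%N, forall t, t \in L -> correct f t &
      forall p, p \in Q -> \sum_(t <- L) (dt_queries t p)%:R <= C * (size L)%:R].

Lemma achievable_scan : achievable n%:R.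
Proof.
exists [:: scan (enum 'I_n)]; split=> [//|t|p _].
  by rewrite inE => /eqP ->; exact: scan_correct.
rewrite big_seq1 mulr1 ler_nat; apply: leq_trans (scan_queries _ _) _.
by rewrite size_enum_ord.
Qed.

Lemma achievable_RS C : 0 <= C -> achievable C -> (RS R f <= C%:E)%E.
Proof. by move=> C0 [L [L0 cL costL]]; exact: RS_le costL. Qed.

(* [retry t s] costs at most [queried t + (1 - finds t) * cost s]; on average over
   [t] this moves the bound [C] towards the ratio [c] by a fraction [d]. *)
Lemma achievable_retry (ts : seq (dtree n)) (c d C : R) :
  (0 < size ts)%N ->
  (forall p, p \in Q -> d * (size ts)%:R <= \sum_(t <- ts) (finds t p)%:R) ->
  (forall p, p \in Q -> \sum_(t <- ts) #|queried t p|%:R <=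
     c * \sum_(t <- ts) (finds t p)%:R) ->
  c <= C -> achievable C -> achievable (C - d * (C - c)).
Proof.
move=> ts0 findD costD cC [L [L0 cL costL]].
exists [seq retry (fun=> None) t s | t <- ts, s <- L]; split=> [|t|p pQ].
- by rewrite size_allpairs muln_gt0 ts0.
- by case/allpairsP=> -[u s] /= [_ sL ->]; apply/retry_correct/cL.
rewrite big_allpairs_dep size_allpairs natrM.
have := findD p pQ; have := costD p pQ; have := costL p pQ.
set F := \sum_(t <- ts) (finds t p)%:R.
set q := \sum_(s <- L) (dt_queries s p)%:R => h1 h2 h3.
apply: (@le_trans _ _ (\sum_(t <- ts) ((size L)%:R * #|queried t p|%:R +
    (1 - (finds t p)%:R) * q))).
  apply: ler_sum => t _; rewrite /q mulr_sumr.
  have -> : (size L)%:R * #|queried t p|%:R = \sum_(s <- L) #|queried t p|%:R :> R.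
    by rewrite big_const_seq count_predT iter_addr addr0 mulr_natl.
  rewrite -big_split; apply: ler_sum => s _ /=.
  have -> : 1 - (finds t p)%:R = (~~ finds t p : nat)%:R :> R.
    by case: finds; rewrite ?subrr ?subr0.
  by rewrite -natrM -natrD ler_nat retry_queries.
rewrite big_split /= -mulr_sumr -mulr_suml sumrB.
rewrite big_const_seq count_predT iter_addr addr0.
have F_le : F <= (size ts)%:R.
  rewrite -[leRHS]mulr1 mulr_natl -[leRHS]addr0 -iter_addr -count_predT -big_const_seq.
  by apply: ler_sum => t _; rewrite lern1 leq_b1.
set A := \sum_(t <- ts) _ in h2 *; set N := (size ts)%:R in h3 F_le *.
(* Together these bound the cost by [size L] times [c * F + (N - F) * C = N * C - F * (C - c)],
   where [F >= d * N]. *)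
have k1 : (size L)%:R * A <= (size L)%:R * (c * F) by rewrite ler_wpM2l.
have k2 : (N - F) * q <= (N - F) * (C * (size L)%:R).
  by rewrite ler_wpM2l // subr_ge0.
have k3 : (size L)%:R * ((C - c) * (d * N)) <= (size L)%:R * ((C - c) * F).
  by rewrite !ler_wpM2l // subr_ge0.
rewrite -[\sum_(i <- ts) (finds i p)%:R]/F. lra.
Qed.

(** Otherwise every distribution admits a tree of ratio below [c]. Minimax turns these trees into
    one list of ratio at most [c1 < RS f] on all sabotaged inputs, and restarting with it pushes
    achievable bounds below [RS f]. *)
Lemma hard_distribution c : 0 < c -> (c%:E < RS R f)%E ->
  exists mu, hard_for f c mu.
Proof.
move=> c0 cRS; apply: contrapT => noMu.
have respond mu : is_distribution Q mu -> exists t,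
    \sum_p mu p * #|queried t p|%:R < c * (\sum_p mu p * (finds t p)%:R).
  move=> dmu; apply: contrapT => noT; apply: noMu; exists mu; split=> // t.
  by rewrite leNgt; apply/negP => ?; apply: noT; exists t.
have [V VE] : exists V : R, RS R f = V%:E.
  have := achievable_RS (ler0n R n) achievable_scan.
  by move: cRS; case: (RS R f) => [r||] //; exists r.
move: cRS; rewrite VE lte_fin => cV.
pose c1 := (c + V) / 2; pose eta := (c1 - c) / c.
have cc1 : c < c1 by rewrite /c1; lra.
have c1V : c1 < V by rewrite /c1; lra.
have eta0 : 0 < eta by rewrite divr_gt0 // subr_gt0.
have c10 : 0 < c1 by lra.
(* Half of the term [eta] survives the minimax error [eta / 2]; this slack forces the list to find a
   mark with probability at least [d = eta / 2 / c1]. *)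
pose v (t : dtree n) p : R := #|queried t p|%:R - c1 * (finds t p)%:R + eta.
have vB t p : `|v t p| <= n%:R + c1 + eta.
  have h1 : #|queried t p|%:R <= n%:R :> R.
    by rewrite ler_nat -[leqRHS]card_ord max_card.
  have h2 : 0 <= #|queried t p|%:R :> R by [].
  rewrite /v ler_norml; case: finds => /=; rewrite ?mulr1 ?mulr0.
    by apply/andP; split; lra.
  by apply/andP; split; lra.
have eta20 : 0 < eta / 2 by lra.
have [mu dmu|ts ts0 Hts] := @approach _ _ _ Q v _ (Leaf n false) vB _ _ eta20.
  have [t Ht] := respond _ dmu; exists t.
  have [mu0 muQ mu1] := dmu.
  set F := \sum_p mu p * (finds t p)%:R in Ht.
  (* The strict inequality [Ht] excludes a leaf, so at least one position is queried on every input.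
     Hence [F >= 1 / c], and [(c1 - c) * F] absorbs [eta = (c1 - c) / c]. *)
  have E1 : 1 <= \sum_p mu p * #|queried t p|%:R.
    case: t @F Ht => [b|i next] F Ht.
      move: Ht; rewrite /F !big1 ?mulr0 ?ltxx // => p _.
        by rewrite finds_leaf mulr0.
      by rewrite /= cards0 mulr0.
    rewrite -[leLHS]mu1; apply: ler_sum => p _; apply: ler_peMr; first exact: mu0.
    by rewrite ler1n; apply/card_gt0P; exists i; rewrite /= !inE eqxx.
  have -> : \sum_p mu p * v t p = \sum_p mu p * #|queried t p|%:R - c1 * F + eta.
    rewrite /v; under eq_bigr do rewrite mulrDr mulrBr.
    rewrite big_split sumrB /= -mulr_suml mu1 mul1r; congr (_ - _ + _).
    by rewrite /F mulr_sumr; apply: eq_bigr => p _; rewrite mulrCA.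
  have F1 : c^-1 <= F.
    by rewrite -[leLHS]mul1r ler_pdivrMr // mulrC ltW // (le_lt_trans E1).
  have : eta <= (c1 - c) * F by rewrite /eta ler_wpM2l // subr_ge0 ltW.
  by lra.
have szts : 0 < (size ts)%:R :> R by rewrite ltr0n.
have tot p : p \in Q -> \sum_(t <- ts) #|queried t p|%:R
    + (size ts)%:R * eta / 2 <= c1 * \sum_(t <- ts) (finds t p)%:R.
  move=> /Hts; rewrite /v big_split sumrB /= -mulr_sumr.
  rewrite big_const_seq count_predT iter_addr addr0 -mulr_natr; lra.
pose d := eta / 2 / c1.
have d0 : 0 < d by apply: divr_gt0 => //; lra.
have findD p : p \in Q -> d * (size ts)%:R <= \sum_(t <- ts) (finds t p)%:R.
  move=> /tot H; rewrite /d mulrAC ler_pdivrMr // mulrC [leRHS]mulrC.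
  have : 0 <= \sum_(t <- ts) #|queried t p|%:R :> R by exact: sumr_ge0.
  by lra.
have costD p : p \in Q -> \sum_(t <- ts) #|queried t p|%:R <=
     c1 * \sum_(t <- ts) (finds t p)%:R.
  move=> /tot H; have : 0 <= (size ts)%:R * eta by rewrite mulr_ge0 // ltW.
  by lra.
have achV C : 0 <= C -> achievable C -> V <= C.
  by move=> C0 /(achievable_RS C0); rewrite VE lee_fin.
(* Each achievable bound is at least [V] but can be lowered by [d * (V - c1)]. *)
have step C : V <= C -> achievable C ->
    V <= C - d * (C - c1) /\ achievable (C - d * (C - c1)).
  move=> VC aC.
  have aC' := achievable_retry ts0 findD costD (ltW (lt_le_trans c1V VC)) aC.
  split=> //.
  (* [achievable_RS] accepts only nonnegative bounds; a negative one would make [0] achievable,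
     hence [V <= 0], against [0 < c1 < V]. *)
  have [C'0|C'0] := leP 0 (C - d * (C - c1)); first exact: achV.
  have : achievable 0.
    case: aC' => L [L0 cL costL]; exists L; split=> // p /costL h.
    rewrite mul0r; apply: le_trans h _; rewrite pmulr_lle0 ?ltr0n //; exact: ltW.
  by move/(achV _ (lexx 0)); lra.
have iter m : exists C, [/\ V <= C, achievable C & C <= n%:R - m%:R * (d * (V - c1))].
  elim: m => [|m [C [VC aC Cm]]].
    exists n%:R; split; [exact/achV/achievable_scan|exact: achievable_scan|].
    by rewrite mul0r subr0.
  have [VC' aC'] := step _ VC aC; exists (C - d * (C - c1)); split=> //.
  by rewrite -natr1; nra.
have g0 : 0 < d * (V - c1) by rewrite mulr_gt0 // subr_gt0.
(* So many steps bring the bound, which starts at [n], below zero, while it must stay above [V]. *)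
have [C [VC _]] := iter (Num.Def.truncn (n%:R / (d * (V - c1)))).+1.
have := truncnS_gt (n%:R / (d * (V - c1))); rewrite ltr_pdivrMr //.
by lra.
Qed.

End Restart.

(** * Independent samples and their resampling *)

Section ProductDistribution.
Variables (R : realType) (I T : finType) (mu : T -> R).
Hypothesis mu1 : \sum_r mu r = 1.

Definition prod_weight (P : {ffun I -> T}) : R := \prod_i mu (P i).

Definition update (P : {ffun I -> T}) i r : {ffun I -> T} :=
  [ffun j => if j == i then r else P j].

Lemma prod_weight_sum1 : \sum_P prod_weight P = 1.
Proof.
by rewrite -(bigA_distr_bigA (fun=> mu)) /= big1.
Qed.

Lemma prod_weight_update P i r :
  prod_weight (update P i r) * mu (P i) = prod_weight P * mu r.
Proof.
rewrite /prod_weight (bigD1 i) // [in RHS](bigD1 i) //= ffunE eqxx.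
rewrite (eq_bigr (fun j => mu (P j))) => [|j ji]; last by rewrite ffunE (negbTE ji).
by ring.
Qed.

(* Exchanging [P i] with the fresh sample [r] preserves the product weight. *)
Lemma resample (i : I) (F : {ffun I -> T} -> R) :
  \sum_P prod_weight P * F P =
  \sum_P prod_weight P * \sum_r mu r * F (update P i r).
Proof.
have -> : \sum_P prod_weight P * F P =
    \sum_P \sum_r prod_weight P * mu r * F P.
  apply: eq_bigr => P _.
  by rewrite -[LHS]mulr1 -mu1 mulr_sumr; apply: eq_bigr => r _; ring.
under [RHS]eq_bigr do rewrite mulr_sumr; rewrite !pair_big /=.
rewrite (reindex_inj (h := fun u => (update u.1 i u.2, u.1 i))) /=.
  by apply: eq_bigr => -[P r] _ /=; rewrite prod_weight_update mulrA.
apply: (can_inj (g := fun u => (update u.1 i u.2, u.1 i))) => -[P r] /=.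
congr (_, _); last by rewrite ffunE eqxx.
by apply/ffunP => j; rewrite !ffunE; case: (eqVneq j i) => [->|].
Qed.

End ProductDistribution.

(** * Sabotaged inputs of a composition, and the trees for [f] and [g] derived from a tree for it *)

Section Composition.
Variables (n k : nat) (f : pfun bool n) (g : pfun bool k).

Definition unindex (l : 'I_(n * k)) : 'I_n * 'I_k :=
  enum_val (cast_ord (esym (mxvec_cast n k)) l).

Lemma unindexK i j : unindex (mxvec_index i j) = (i, j).
Proof. by rewrite /unindex /mxvec_index cast_ordK enum_rankK. Qed.

Lemma mxvec_index_unindex l : mxvec_index (unindex l).1 (unindex l).2 = l.
Proof. by case/mxvec_indexP: l => i j; rewrite unindexK. Qed.

Definition completion (b : bool) (q : {ffun 'I_k -> symbol}) : {ffun 'I_k -> bool} :=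
  odflt [ffun=> false]
    [pick x | (g x == Some b) && [forall j, is_mark (q j) || (Bit (x j) == q j)]].

(** The two inputs witnessing that [q] is sabotaged have different values, so one of them has value
    [b]; the default of [completion] is thus never reached. *)
Lemma completionP b q : q \in pdom (fsab g) ->
  g (completion b q) = Some b /\
  forall j, ~~ is_mark (q j) -> Bit (completion b q j) = q j.
Proof.
case/pdom_fsabP=> c /fsabP/sabotagedP[x [y [gx gy gxy H]]].
have q_mark j : ~~ is_mark (q j) -> q j != if c then Dagger else Star.
  by case: (c); case: (q j).
have [u [gu uq]] : exists u, g u = Some b /\
    forall j, ~~ is_mark (q j) -> Bit (u j) = q j.
  have [gxb|gxb] := eqVneq (g x) (Some b).
    by exists x; split=> // j /q_mark/H[].
  exists y; split=> [|j /q_mark/H[] //].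
  by case: (g x) (g y) gx gy gxy gxb => [[]|] // [[]|] //; case: (b).
rewrite /completion; case: pickP => [v /andP[/eqP gv /forallP vq]|/(_ u)] /=.
  by split=> // j qj; have := vq j; rewrite (negbTE qj) => /eqP.
rewrite gu eqxx /= => /negP[]; apply/forallP => j.
by case: (boolP (is_mark _)) => //= /uq ->.
Qed.

Definition fill (q : {ffun 'I_k -> symbol}) (j : 'I_k) (a : symbol) : symbol :=
  if is_mark (q j) then (if a is Bit b then Bit (completion b q j) else a)
  else q j.

Definition merge_blocks (p : {ffun 'I_n -> symbol})
    (P : {ffun 'I_n -> {ffun 'I_k -> symbol}}) : {ffun 'I_(n * k) -> symbol} :=
  [ffun l => fill (P (unindex l).1) (unindex l).2 (p (unindex l).1)].

(** The witnesses [x] and [y] for [p] lift blockwise through [completion]. The lifts coincide on a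
    block where [p i] is a bit, and agree at the unmarked positions of [P i] elsewhere. *)
Lemma merge_blocks_sabotaged p (P : {ffun _ -> _}) :
  p \in pdom (fsab f) -> (forall i, P i \in pdom (fsab g)) ->
  merge_blocks p P \in pdom (fsab (pfun_comp f g)).
Proof.
case/pdom_fsabP=> c /fsabP/sabotagedP[x [y [fx fy fxy H]]] PQ.
pose lift_in (u : {ffun 'I_n -> bool}) : {ffun 'I_(n * k) -> bool} :=
  [ffun l => completion (u (unindex l).1) (P (unindex l).1) (unindex l).2].
have lift_block u i : g (block (lift_in u) i) = Some (u i).
  rewrite -(completionP (u i) (PQ i)).1; congr g.
  by apply/ffunP => j; rewrite !ffunE unindexK.
have lift_comp u : pfun_comp f g (lift_in u) = f u.
  rewrite /pfun_comp ifT; last by apply/forallP => i; rewrite inE lift_block.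
  by congr f; apply/ffunP => i; rewrite ffunE lift_block.
apply/pdom_fsabP; exists c; apply/fsabP/sabotagedP.
exists (lift_in x), (lift_in y); rewrite !lift_comp; split=> // l.
rewrite !ffunE; case: (unindex l) => i j /=; rewrite /fill.
case: ifPn => [_|Pij _]; last by rewrite !(completionP _ (PQ i)).2.
case pi: (p i) => [b||] ps; last 2 first.
- by have := H i; rewrite pi => /(_ ps)[].
- by have := H i; rewrite pi => /(_ ps)[].
have [|xi yi] := H i; first by rewrite pi; case: (c).
by move: xi yi; rewrite pi => -[->] [->].
Qed.

(** The block's own symbols are the input of the new tree; all others come from [z]. The tree stops
    at its first mark, beyond which the answer given to [t] would depend on [p i]. *)
Fixpoint restrict_block (t : dtree (n * k)) (z : {ffun 'I_(n * k) -> symbol})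
    (i : 'I_n) : dtree k :=
  match t with
  | Leaf b => Leaf k b
  | Query l next =>
    if (unindex l).1 == i then
      Query (unindex l).2
        (fun a => if is_mark a then Leaf k false else restrict_block (next a) z i)
    else restrict_block (next (z l)) z i
  end.

(* An unmarked [P i j] is the answer whatever [p i] is, so [p i] is queried only
   when the tree hits a mark of the i-th block. *)
Fixpoint simulate (t : dtree (n * k)) (P : {ffun 'I_n -> {ffun 'I_k -> symbol}}) :
    dtree n :=
  match t with
  | Leaf b => Leaf n b
  | Query l next =>
    let: (i, j) := unindex l in
    if is_mark (P i j) then Query i (fun a => simulate (next (fill (P i) j a)) P)
    else simulate (next (P i j)) P
  end.

Lemma restrict_block_queried t p P i j :
  j \in queried (restrict_block t (merge_blocks p P) i) (P i) ->
  mxvec_index i j \in queried t (merge_blocks p P).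
Proof.
elim: t => [b|l next IH] /=; first by rewrite inE.
case: ifPn => [/eqP li|li] /=; last by move/IH; rewrite !inE => ->; rewrite orbT.
rewrite !inE => /orP[/eqP ->|]; first by rewrite -li mxvec_index_unindex eqxx.
rewrite [merge_blocks p P l]ffunE -li /fill; case: ifPn => _; first by rewrite inE.
by rewrite li => /IH ->; rewrite orbT.
Qed.

(** [p i] is requested only at a mark of [P i] reached by the run of [t], and the restricted tree
    follows this run up to the first such mark. *)
Lemma simulate_queried t p P i :
  i \in queried (simulate t P) p ->
  finds (restrict_block t (merge_blocks p P) i) (P i).
Proof.
elim: t => [b|l next IH] /=; first by rewrite inE.
case ul: (unindex l) => [i' j] /=.
have zl : merge_blocks p P l = fill (P i') j (p i') by rewrite ffunE ul.
case: ifPn => Pij /=.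
  rewrite !inE => /orP[/eqP ->|]; first by rewrite eqxx finds_query Pij.
  rewrite -zl => /IH; case: eqP => [<-|//].
  by rewrite finds_query Pij.
rewrite -[P i' j](_ : merge_blocks p P l = _); last by rewrite zl /fill (negbTE Pij).
move/IH; case: eqP => [<-|//]; rewrite finds_query.
have -> : P i' j = merge_blocks p P l by rewrite zl /fill (negbTE Pij).
rewrite ifF ?orbT //; last by rewrite zl /fill !(negbTE Pij).
by move=> ->; rewrite orbT.
Qed.

(** A mark of the merged input lies at a mark of some [P i] with [p i] itself a mark, and there the
    simulation queries [p i]. *)
Lemma simulate_finds t p P :
  finds t (merge_blocks p P) -> finds (simulate t P) p.
Proof.
elim: t => [b|l next IH]; first by rewrite finds_leaf.
rewrite finds_query /=; case ul: (unindex l) => [i j].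
have zl : merge_blocks p P l = fill (P i) j (p i) by rewrite ffunE ul.
case: ifPn => Pij.
  rewrite finds_query -zl => /orP[|/IH ->]; last by rewrite orbT.
  by rewrite zl /fill Pij; case: (p i).
have -> : P i j = merge_blocks p P l by rewrite zl /fill (negbTE Pij).
case/orP=> [|/IH //]; by rewrite zl /fill (negbTE Pij) (negbTE Pij).
Qed.

(** [z] is read only outside block [i], so this block can be resampled without changing the tree. *)
Lemma restrict_block_update t p P i r :
  restrict_block t (merge_blocks p (update P i r)) i =
  restrict_block t (merge_blocks p P) i.
Proof.
elim: t => //= l next IH; case: ifPn => li.
  by congr Query; apply/funext => a; case: ifP.
by rewrite IH; congr (restrict_block (next _) _ _); rewrite !ffunE (negbTE li).
Qed.

Lemma sum_restrict_block_queried t p P :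
  (\sum_i #|queried (restrict_block t (merge_blocks p P) i) (P i)| <=
   dt_queries t (merge_blocks p P))%N.
Proof.
apply: leq_trans (card_queried t _).
rewrite (eq_bigr (fun i : 'I_n =>
  \sum_(j in queried (restrict_block t (merge_blocks p P) i) (P i)) 1)%N); last first.
  by move=> i _; rewrite sum1_card.
have inj : injective (uncurry (@mxvec_index n k)).
  by apply: (can_inj (g := unindex)) => -[i j]; exact: unindexK.
rewrite pair_big_dep /= sum1_card -(fintype.card_image inj).
apply: subset_leq_card; apply/fintype.subsetP => l /fintype.imageP[[i j] /= ij ->].
exact: restrict_block_queried.
Qed.

(** * Expected costs under the product of hard distributions *)

Section Expectation.
Variables (R : realType) (c d : R).
Variables (lam : {ffun 'I_n -> symbol} -> R) (mu : {ffun 'I_k -> symbol} -> R).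
Hypotheses (d0 : 0 <= d) (lam_hard : hard_for f c lam) (mu_hard : hard_for g d mu).

(** With the other blocks fixed and block [i] resampled from [mu], a single tree for [g] faces [mu],
    and its hardness applies. *)
Lemma block_cost t p i :
  d * \sum_P prod_weight mu P *
        (finds (restrict_block t (merge_blocks p P) i) (P i))%:R <=
  \sum_P prod_weight mu P *
        #|queried (restrict_block t (merge_blocks p P) i) (P i)|%:R.
Proof.
have [[mu0 muQ mu1] hmu] := mu_hard.
rewrite (resample mu1 i) [leRHS](resample mu1 i) mulr_sumr; apply: ler_sum => P _.
rewrite mulrCA ler_wpM2l ?prodr_ge0 //.
under eq_bigr do rewrite restrict_block_update ffunE eqxx.
under [leRHS]eq_bigr do rewrite restrict_block_update ffunE eqxx.
exact: hmu.
Qed.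

Lemma simulate_cost t p :
  d * \sum_P prod_weight mu P * #|queried (simulate t P) p|%:R <=
  \sum_P prod_weight mu P * (dt_queries t (merge_blocks p P))%:R.
Proof.
have [[mu0 muQ mu1] hmu] := mu_hard.
have w0 P : 0 <= prod_weight (I := 'I_n) mu P by exact: prodr_ge0.
apply: (@le_trans _ _ (\sum_P prod_weight mu P *
    \sum_i #|queried (restrict_block t (merge_blocks p P) i) (P i)|%:R)); last first.
  apply: ler_sum => P _; rewrite ler_wpM2l //.
  by rewrite -natr_sum ler_nat sum_restrict_block_queried.
apply: (@le_trans _ _ (d * \sum_P prod_weight mu P *
    \sum_i (finds (restrict_block t (merge_blocks p P) i) (P i))%:R)).
  rewrite ler_wpM2l //; apply: ler_sum => P _; rewrite ler_wpM2l //.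
  rewrite -natr_sum ler_nat -sum1_card [leqLHS]big_mkcond /=.
  by apply: leq_sum => i _; case: ifP => // /simulate_queried ->.
under eq_bigr do rewrite mulr_sumr; rewrite exchange_big mulr_sumr /=.
under [leRHS]eq_bigr do rewrite mulr_sumr; rewrite [leRHS]exchange_big /=.
by apply: ler_sum => i _; exact: block_cost.
Qed.

(** For fixed [P], correctness of [t] makes [simulate t P] find a mark on every sabotaged [p], so
    hardness of [lam] yields [c] queried blocks on average; [simulate_cost] charges [d] for each. *)
Lemma composed_cost t : correct (pfun_comp f g) t ->
  c * d <= \sum_p \sum_P lam p * prod_weight mu P * (dt_queries t (merge_blocks p P))%:R.
Proof.
move=> ct; have [[mu0 muQ mu1] _] := mu_hard; have [[lam0 lamQ lam1] hlam] := lam_hard.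
have w0 P : 0 <= prod_weight (I := 'I_n) mu P by exact: prodr_ge0.
apply: (@le_trans _ _ (\sum_p lam p *
    (d * \sum_P prod_weight mu P * #|queried (simulate t P) p|%:R))); last first.
  apply: ler_sum => p _; under [leRHS]eq_bigr do rewrite -mulrA.
  by rewrite -mulr_sumr ler_wpM2l // simulate_cost.
under eq_bigr do rewrite mulrCA mulr_sumr; rewrite -mulr_sumr mulrC ler_wpM2l //.
rewrite exchange_big /=; under eq_bigr do under eq_bigr do rewrite mulrCA.
under eq_bigr do rewrite -mulr_sumr.
apply: (@le_trans _ _ (\sum_P prod_weight (I := 'I_n) mu P * c)).
  by rewrite -mulr_suml prod_weight_sum1 // mul1r.
apply: ler_sum => P _.
(* A tuple with a block that is not sabotaged has weight zero. *)
have [PQ|] := boolP [forall i, P i \in pdom (fsab g)]; last first.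
  rewrite negb_forall => /existsP[i /muQ Pi].
  by rewrite /prod_weight (bigD1 i) //= Pi !mul0r.
rewrite ler_wpM2l //; apply: le_trans (hlam (simulate t P)).
suff -> : \sum_p lam p * (finds (simulate t P) p)%:R = 1 by rewrite mulr1.
rewrite -[RHS]lam1; apply: eq_bigr => p _.
have [pQ|/lamQ ->] := boolP (p \in pdom (fsab f)); last by rewrite mul0r.
have fin : finds t (merge_blocks p P).
  by apply: (correct_finds ct); apply: merge_blocks_sabotaged => //; exact/forallP.
by rewrite (simulate_finds fin) mulr1.
Qed.

End Expectation.
End Composition.

(** * From distributions on inputs to randomized algorithms *)

Lemma esumZ_le (R : realType) (T : choiceType) (r : R) (a : T -> \bar R) :
  0 <= r -> (forall x, 0 <= a x)%E ->
  (\esum_(x in [set: T]) (r%:E * a x) <= r%:E * \esum_(x in [set: T]) a x)%E.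
Proof.
move=> r0 a0; apply: ge_ereal_sup => _ [X [finX XT] <-].
rewrite -ge0_mule_fsumr // lee_wpmul2l ?lee_fin //.
by apply: ereal_sup_ubound; exists X.
Qed.

Lemma expected_queries_ge0 (R : realType) n (w : ralg R n) x :
  (0 <= expected_queries w x)%E.
Proof. by apply: esum_ge0 => t _; rewrite lee_fin mulr_ge0 // weight_ge0. Qed.

(** The easy direction of Yao's principle: the worst input costs at least the average one, and
    exchanging the two sums reduces the bound to single trees. *)
Lemma expected_queries_average (R : realType) n (w : ralg R n) (h : pfun symbol n)
    (J : finType) (m : J -> R) (z : J -> {ffun 'I_n -> symbol}) (e : R) :
  (forall j, 0 <= m j) -> \sum_j m j = 1 ->
  (forall j, m j != 0 -> z j \in pdom h) -> 0 < e ->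
  (forall t, 0 < w t -> e <= \sum_j m j * (dt_queries t (z j))%:R) ->
  (e%:E <= worst_case h w)%E.
Proof.
move=> m0 m1 zD e0 He.
apply: (@le_trans _ _ (\sum_j (m j)%:E * expected_queries w (z j))%E).
  have Fe0 t : (0 <= \sum_j ((m j)%:E * (w t * (dt_queries t (z j))%:R)%:E))%E.
    apply: sume_ge0 => j _; rewrite -EFinM lee_fin !mulr_ge0 //; exact: weight_ge0.
  apply: (@le_trans _ _ (\esum_(t in [set: dtree n])
      \sum_j ((m j)%:E * (w t * (dt_queries t (z j))%:R)%:E))%E); last first.
    rewrite esum_sum => [|t j _ _]; last first.
      by rewrite -EFinM lee_fin !mulr_ge0 //; exact: weight_ge0.
    apply: lee_sum => j _; apply: esumZ_le => // t.
    by rewrite lee_fin mulr_ge0 //; exact: weight_ge0.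
  rewrite -[leLHS]mule1 -(lee_pdivlMl _ _ e0) -(weight_sum1 w).
  have ie0 : 0 <= e^-1 by rewrite invr_ge0 ltW.
  apply: le_trans (esumZ_le ie0 Fe0).
  apply: le_esum => t _; rewrite lee_pdivlMl //.
  have [wt0|wt] := eqVneq (w t) 0; first by rewrite {1}wt0 mule0; exact: Fe0.
  under eq_bigr do rewrite -EFinM; rewrite sumEFin -EFinM lee_fin.
  under eq_bigr do rewrite mulrCA.
  rewrite -mulr_sumr mulrC ler_wpM2l ?weight_ge0 //.
  by apply: He; rewrite lt0r wt weight_ge0.
have W0 : (0 <= worst_case h w)%E by exact: bigmax_ge_id.
rewrite -[leRHS]mul1e -m1 -sumEFin ge0_sume_distrl; last by move=> j _; rewrite lee_fin.
apply: lee_sum => j _; have [->|mj] := eqVneq (m j) 0; first by rewrite !mul0e.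
by rewrite lee_wpmul2l ?lee_fin //; apply: le_bigmax_cond; exact: zD.
Qed.

Lemma RS_comp_ge (R : realType) (n k : nat) (f : pfun bool n) (g : pfun bool k)
    (c d : R) : 0 < c -> 0 < d -> (c%:E < RS R f)%E -> (d%:E < RS R g)%E ->
  ((c * d)%:E <= RS R (pfun_comp f g))%E.
Proof.
move=> c0 d0 cf dg.
have [lam lamH] := hard_distribution c0 cf.
have [mu muH] := hard_distribution d0 dg.
have [[lam0 lamQ lam1] _] := lamH; have [[mu0 muQ mu1] _] := muH.
apply: le_ereal_inf_tmp => _ [w w0 <-].
pose J : finType := ({ffun 'I_n -> symbol} * {ffun 'I_n -> {ffun 'I_k -> symbol}})%type.
pose m (u : J) : R := lam u.1 * prod_weight mu u.2.
pose z (u : J) := merge_blocks g u.1 u.2.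
apply: (@expected_queries_average _ _ _ _ J m z) => [u|||//|t wt].
- by rewrite mulr_ge0 ?prodr_ge0.
- rewrite -(pair_bigA _ (fun p P => lam p * prod_weight (I := 'I_n) mu P)) /=.
  by under eq_bigr do rewrite -mulr_sumr prod_weight_sum1 // mulr1.
- move=> -[p P]; rewrite mulf_eq0 negb_or => /andP[lp MP].
  apply: merge_blocks_sabotaged => [|i]; first by apply: contraNT lp => /lamQ ->.
  apply: contraNT MP => /muQ Pi.
  by rewrite /prod_weight (bigD1 i) //= Pi mul0r.
- by rewrite mulr_gt0.
rewrite -(pair_bigA _ (fun p P =>
  lam p * prod_weight (I := 'I_n) mu P * (dt_queries t (merge_blocks g p P))%:R)) /=.
by apply: (composed_cost (ltW d0) lamH muH) => x; exact: w0.
Qed.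

Theorem theorem19 (R : realType) (n k : nat) (f : pfun bool n) (g : pfun bool k) :
  (RS R f * RS R g <= RS R (pfun_comp f g))%E.
Proof.
have RS_ge0 m (h : pfun bool m) : (0 <= RS R h)%E.
  by apply: le_ereal_inf_tmp => _ [w _ <-]; exact: bigmax_ge_id.
have RS_fin m (h : pfun bool m) : exists2 a : R, 0 <= a & RS R h = a%:E.
  have := achievable_RS (ler0n R m) (achievable_scan R h).
  have := RS_ge0 m h; case: (RS R h) => [a||] //; by exists a.
have [a a0 fa] := RS_fin _ f; have [b b0 gb] := RS_fin _ g.
have [r r0 fgr] := RS_fin _ (pfun_comp f g).
rewrite fa gb fgr -EFinM lee_fin leNgt; apply/negP => r_ab.
have ab0 : 0 < a * b by exact: le_lt_trans r_ab.
have agt0 : 0 < a.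
  by rewrite lt0r a0 andbT; apply: contraTneq ab0 => ->; rewrite mul0r ltxx.
have bgt0 : 0 < b.
  by rewrite lt0r b0 andbT; apply: contraTneq ab0 => ->; rewrite mulr0 ltxx.
(* Chosen so that [2 * s * (a * b) = a * b - r]; then [(1 - s) ^ 2 * (a * b)] exceeds [r] by
   [s ^ 2 * (a * b)], contradicting [RS_comp_ge]. *)
pose s := (a * b - r) / (a * b) / 2.
have sE : s * (a * b) = (a * b - r) / 2 by rewrite /s; field; rewrite ?gt_eqF.
have s0 : 0 < s by rewrite !divr_gt0 // subr_gt0.
have s1 : s < 1 by rewrite -(ltr_pM2r ab0) sE mul1r; lra.
have := @RS_comp_ge R _ _ f g (a * (1 - s)) (b * (1 - s)).
rewrite fa gb fgr !lte_fin lee_fin.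
have t0 : 0 < 1 - s by rewrite subr_gt0.
rewrite !mulr_gt0 // !gtr_pMr // ltrBlDr ltrDl s0 => /(_ isT isT isT isT).
by nra.
Qed.
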